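(* Let $\Delta(A)$ be a tuple generating or equality generating dependency, and let $\vec v$ be a tuple of distinct variables whose length equals the arity of $A$. Then there exists an inclusion/exclusion logic formula (and also an independence logic formula) $\phi(\vec v)$, with free variables in $\vec v$, such that $$M \models_X \phi(\vec v) \Leftrightarrow M \models \Delta(\mathrm{Rel}_{\vec v}(X))$$ for all models $M$ and all teams $X$ over $M$ whose domain contains $\vec v$.
   Context: All first order models are assumed to have at least two elements in their domain; $\mathrm{Dom}(M)$ is the domain of $M$. An assignment over $M$ is a function from a set of variables to $\mathrm{Dom}(M)$; $s[m/x]$ sends $x$ to $m$ and otherwise agrees with $s$; $t\langle s\rangle$ is the value of the term $t$ in $M$ under $s$, and $\vec t\langle s\rangle$ is the corresponding tuple of values. A team $X$ over $M$ is a set of assignments over $M$ all having the same domain, called the domain of $X$. For a tuple of variables $\vec v=v_1\ldots v_k$ in the domain of $X$, $\mathrm{Rel}_{\vec v}(X)=\{(s(v_1),\ldots,s(v_k)):s\in X\}$. A tuple generating dependency is a sentence $\Delta(A)=\forall x_1\ldots x_n(\phi(x_1,\ldots,x_n)\rightarrow\exists z_1\ldots z_k\,\psi(x_1,\ldots,x_n,z_1,\ldots,z_k))$, where $A$ is a relation (second order) variable and $\phi$ and $\psi$ are conjunctions of atoms of the form $A\vec t$ or $\vec t_1=\vec t_2$ (componentwise equality), with terms in the empty vocabulary (i.e. variables) among $x_1,\ldots,x_n$ for $\phi$ and among $x_1,\ldots,x_n,z_1,\ldots,z_k$ for $\psi$. An equality generating dependency is defined in the same way except that $\psi$ is a single equality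 atom. $M\models\Delta(R)$ is ordinary first order satisfaction with $A$ interpreted as $R$. All formulas are in negation normal form and are built using $\wedge,\vee,\exists x,\forall x$ from first order literals together with: for inclusion/exclusion logic, inclusion atoms $\vec t_1 \subseteq \vec t_2$ and exclusion atoms $\vec t_1 ~|~ \vec t_2$ ($\vec t_1,\vec t_2$ finite tuples of terms of the same length); for independence logic, independence atoms $\vec t_2 ~\bot_{\vec t_1}~ \vec t_3$ (finite, possibly empty, tuples of terms, not necessarily of the same length). The satisfaction relation $M\models_X\phi$ (lax team semantics), where the domain of $X$ contains the free variables of $\phi$, is: - for a first order literal $\phi$: $M\models_s\phi$ (Tarski) for all $s\in X$; - $M\models_X \vec t_1\subseteq\vec t_2$ iff for every $s\in X$ there is $s'\in X$ with $\vec t_1\langle s\rangle=\vec t_2\langle s'\rangle$; - $M\models_X \vec t_1~|~\vec t_2$ iff for all $s,s'\in X$, $\vec t_1\langle s\rangle\neq\vec t_2\langle s'\rangle$; - $M\models_X \vec t_2 ~\bot_{\vec t_1}~ \vec t_3$ iff for all $s,s'\in X$ with $\vec t_1\langle s\rangle=\vec t_1\langle s'\rangle$ there is $s''\in X$ with $\vec t_1\langle s''\rangle\vec t_2\langle s''\rangle=\vec t_1\langle s\rangle\vec t_2\langle s\rangle$ and $\vec t_1\langle s''\rangle\vec t_3\langle s''\rangle=\vec t_1\langle s'\rangle\vec t_3\langle s'\rangle$; - $M\models_X\psi\vee\theta$ iff $X=Y\cup Z$ for some teams $Y,Z$ with $M\models_Y\psi$ and $M\models_Z\theta$; - $M\models_X\psi\wedge\theta$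 iff $M\models_X\psi$ and $M\models_X\theta$; - $M\models_X\exists x\psi$ iff there is $H:X\to\mathcal P(\mathrm{Dom}(M))\setminus\{\emptyset\}$ with $M\models_{X[H/x]}\psi$, where $X[H/x]=\{s[m/x]:s\in X,\ m\in H(s)\}$; - $M\models_X\forall x\psi$ iff $M\models_{X[M/x]}\psi$, where $X[M/x]=\{s[m/x]:s\in X,\ m\in\mathrm{Dom}(M)\}$.
   Formalization: The equivalence is claimed for all nonempty teams, and for the empty team only when the premise of Δ contains an atom on A; otherwise it can fail: every formula holds in the empty team, while e.g. ∀x(x=x → ∃z Az) is false for the empty relation. *)

(* Defs.v *)
From mathcomp Require Import all_boot.
From mathcomp Require Import boolp classical_sets.

Set Implicit Arguments.
Unset Strict Implicit.
Unset Printing Implicit Defensive.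

Local Open Scope classical_set_scope.

Record signature := Signature {
  fsym : Type;
  farity : fsym -> nat;
  rsym : Type;
  rarity : rsym -> nat
}.

Record model (S : signature) := Model {
  dom :> Type;
  two_elements : exists a b : dom, a <> b;
  finterp : forall f : fsym S, ('I_(farity f) -> dom) -> dom;
  rinterp : forall p : rsym S, set ('I_(rarity p) -> dom)
}.

Definition var := nat.

Inductive term (S : signature) :=
| Var (x : var)
| App (f : fsym S) (ts : 'I_(farity f) -> term S).

Fixpoint term_fv S (t : term S) : set var :=
  match t with
  | Var x => [set x]
  | App f ts => [set y | exists i, term_fv (ts i) y]
  end.

Definition tuple_fv S k (ts : k.-tuple (term S)) : set var :=
  [set y | exists i, term_fv (tnth ts i) y].

(* An assignment with domain D is a partial function on the variables that is
   defined exactly on D. *)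
Definition assignment S (M : model S) := var -> option M.

Definition domain S (M : model S) (s : assignment M) : set var :=
  [set x | isSome (s x)].

Definition upd S (M : model S) (s : assignment M) (x : var) (m : M)
  : assignment M := fun y => if y == x then Some m else s y.

Lemma dom_inhabited S (M : model S) : exists a : M, True.
Proof. by case: (two_elements M) => a _; exists a. Qed.

Definition junk S (M : model S) : M := projT1 (cid (dom_inhabited M)).

(* The junk value is returned only for variables outside the domain of s. *)
Definition aval S (M : model S) (s : assignment M) (x : var) : M :=
  odflt (junk M) (s x).

Fixpoint tval S (M : model S) (s : assignment M) (t : term S) : M :=
  match t with
  | Var x => aval s x
  | App f ts => finterp (fun i => tval s (ts i))
  end.

Definition tsval S (M : model S) (s : assignment M) k
  (ts : k.-tuple (term S)) : k.-tuple M := map_tuple (tval s) ts.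

Inductive literal (S : signature) :=
| Rel (p : rsym S) (ts : 'I_(rarity p) -> term S)
| NRel (p : rsym S) (ts : 'I_(rarity p) -> term S)
| Eq (t u : term S)
| NEq (t u : term S).

Definition literal_fv S (l : literal S) : set var :=
  match l with
  | Rel p ts | NRel p ts => [set y | exists i, term_fv (ts i) y]
  | Eq t u | NEq t u => term_fv t `|` term_fv u
  end.

Definition literal_sat S (M : model S) (s : assignment M) (l : literal S)
  : Prop :=
  match l with
  | Rel p ts => rinterp (fun i => tval s (ts i))
  | NRel p ts => ~ rinterp (fun i => tval s (ts i))
  | Eq t u => tval s t = tval s u
  | NEq t u => tval s t <> tval s u
  end.

Inductive ie_atom (S : signature) :=
| Inclusion k (t1 t2 : k.-tuple (term S))
| Exclusion k (t1 t2 : k.-tuple (term S)).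

Definition ie_fv S (a : ie_atom S) : set var :=
  match a with
  | Inclusion _ t1 t2 | Exclusion _ t1 t2 => tuple_fv t1 `|` tuple_fv t2
  end.

Definition ie_sat S (M : model S) (X : set (assignment M)) (a : ie_atom S)
  : Prop :=
  match a with
  | Inclusion _ t1 t2 =>
      forall s, X s -> exists2 s', X s' & tsval s t1 = tsval s' t2
  | Exclusion _ t1 t2 =>
      forall s s', X s -> X s' -> tsval s t1 <> tsval s' t2
  end.

(* [Independence t2 t1 t3] is the atom t2 _|_(t1) t3. *)
Inductive ind_atom (S : signature) :=
| Independence k2 k1 k3 (t2 : k2.-tuple (term S)) (t1 : k1.-tuple (term S))
    (t3 : k3.-tuple (term S)).

Definition ind_fv S (a : ind_atom S) : set var :=
  let: Independence _ _ _ t2 t1 t3 := a in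
  tuple_fv t2 `|` tuple_fv t1 `|` tuple_fv t3.

Definition ind_sat S (M : model S) (X : set (assignment M)) (a : ind_atom S)
  : Prop :=
  let: Independence _ _ _ t2 t1 t3 := a in
  forall s s', X s -> X s' -> tsval s t1 = tsval s' t1 ->
  exists2 s'', X s'' &
    (tsval s'' t1 = tsval s t1 /\ tsval s'' t2 = tsval s t2) /\
    (tsval s'' t1 = tsval s' t1 /\ tsval s'' t3 = tsval s' t3).

(* Formulas in negation normal form over a type A of team-semantical atoms. *)
Inductive formula (S : signature) (A : Type) :=
| Lit (l : literal S)
| Atom (a : A)
| And (p q : formula S A)
| Or (p q : formula S A)
| Ex (x : var) (p : formula S A)
| All (x : var) (p : formula S A).

Fixpoint free_vars S A (afv : A -> set var) (p : formula S A) : set var :=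
  match p with
  | Lit l => literal_fv l
  | Atom a => afv a
  | And p q | Or p q => free_vars afv p `|` free_vars afv q
  | Ex x p | All x p => free_vars afv p `\ x
  end.

(* A team is a set of assignments with a common domain; the empty team has
   every domain. *)
Definition team_on S (M : model S) (D : set var) (X : set (assignment M))
  : Prop := forall s, X s -> domain s = D.

Definition team_supplement S (M : model S) (X : set (assignment M))
  (H : assignment M -> set M) (x : var) : set (assignment M) :=
  [set s' | exists s m, [/\ X s, H s m & s' = upd s x m]].

Definition team_duplicate S (M : model S) (X : set (assignment M)) (x : var)
  : set (assignment M) := [set s' | exists s m, X s /\ s' = upd s x m].

(* The sets Y and Z in the disjunction clause, being subsets of X, are teams
   with the domain of X. *)
Fixpoint team_sat S A (M : model S) (asat : set (assignment M) -> A -> Prop)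
  (X : set (assignment M)) (p : formula S A) : Prop :=
  match p with
  | Lit l => forall s, X s -> literal_sat s l
  | Atom a => asat X a
  | And p q => team_sat asat X p /\ team_sat asat X q
  | Or p q => exists Y Z : set (assignment M),
      [/\ X = Y `|` Z, team_sat asat Y p & team_sat asat Z q]
  | Ex x p => exists2 H : assignment M -> set M,
      (forall s, X s -> H s !=set0) & team_sat asat (team_supplement X H x) p
  | All x p => team_sat asat (team_duplicate X x) p
  end.

Definition ie_formula S := formula S (ie_atom S).
Definition ie_free_vars S (p : ie_formula S) := free_vars (@ie_fv S) p.
Definition ie_team_sat S (M : model S) (X : set (assignment M))
  (p : ie_formula S) := team_sat (@ie_sat S M) X p.

Definition ind_formula S := formula S (ind_atom S).
Definition ind_free_vars S (p : ind_formula S) := free_vars (@ind_fv S) p.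
Definition ind_team_sat S (M : model S) (X : set (assignment M))
  (p : ind_formula S) := team_sat (@ind_sat S M) X p.

Definition team_rel S (M : model S) (X : set (assignment M)) r
  (v : r.-tuple var) : set (r.-tuple M) :=
  [set m | exists2 s, X s & m = map_tuple (aval s) v].

(* Atoms of a dependency on a relation variable of arity r, over the finite set
   V of variables. *)
Inductive dep_atom (r : nat) (V : Type) :=
| DRel (ts : r.-tuple V)
| DEq l (ts us : l.-tuple V).
Arguments DRel {r V} ts.
Arguments DEq {r V l} ts us.

(* The universal variables are indexed by 'I_n and the existential ones by
   'I_k; lists of atoms are conjunctions. *)
Inductive dependency (r : nat) :=
| TGD n k (premise : seq (dep_atom r 'I_n))
    (conclusion : seq (dep_atom r ('I_n + 'I_k)))
| EGD n k (premise : seq (dep_atom r 'I_n))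
    l (ts us : l.-tuple ('I_n + 'I_k)%type).

Definition dep_atom_sat r V T (R : set (r.-tuple T)) (e : V -> T)
  (a : dep_atom r V) : Prop :=
  match a with
  | DRel ts => R (map_tuple e ts)
  | DEq _ ts us => map_tuple e ts = map_tuple e us
  end.

Definition conj_sat r V T (R : set (r.-tuple T)) (e : V -> T)
  (c : seq (dep_atom r V)) : Prop :=
  foldr (fun a P => dep_atom_sat R e a /\ P) True c.

Definition sum_env T n k (e : 'I_n -> T) (f : 'I_k -> T) (i : 'I_n + 'I_k)
  : T := match i with inl i => e i | inr j => f j end.

Definition dep_sat S (M : model S) r (R : set (r.-tuple M))
  (D : dependency r) : Prop :=
  match D with
  | TGD n k prem concl =>
      forall e : 'I_n -> M, conj_sat R e prem ->
      exists f : 'I_k -> M, conj_sat R (sum_env e f) concl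
  | EGD n k prem _ ts us =>
      forall e : 'I_n -> M, conj_sat R e prem ->
      exists f : 'I_k -> M, dep_atom_sat R (sum_env e f) (DEq ts us)
  end.

Definition is_DRel r V (a : dep_atom r V) : bool :=
  if a is DRel _ then true else false.

(* The premise has an atom on the relation variable, so that the dependency
   holds of the empty relation.  Every formula is satisfied by the empty team,
   but a dependency without such an atom, like forall x (x = x -> exists z A z),
   may be false of the empty relation. *)
Definition relational_premise r (D : dependency r) : bool :=
  match D with
  | TGD _ _ prem _ => has (@is_DRel r _) prem
  | EGD _ _ prem _ _ _ => has (@is_DRel r _) prem
  end.

(* Main.v *)
(* The relation of the team must survive the splitting done by disjunctions, so
   every use of it is moved to atoms placed outside the disjunctions.  The
   formula for forall x (phi -> exists z psi) is

     forall c a b x y_1 ... y_m exists p_1 ... p_m u_1 ... u_l z,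
       (atoms) /\ (y_i = v -> p_i <> c) /\ (a = c -> u_j = v) /\
       (a = c \/ b <> c \/ some premise fails \/ all conclusions hold),

   where "A t fails" is rendered by y_i <> t \/ p_i = c in the premise, and "A t
   holds" by u_j = t in the conclusion.  The atoms make p_i = c imply that y_i is
   outside the relation, and make u_j a row of the relation: for inclusion and
   exclusion they are p_i c y_i | c c v and u_j <= v, and for independence p_i is
   a function of c y_i and u_j is independent of a c.  In the latter case, the
   assignments with a <> c and b <> c carry no constraint on u_j, which leaves
   room for all rows of the relation. *)
Require Import Defs.
From mathcomp Require Import all_boot.
From mathcomp Require Import boolp classical_sets.

Local Open Scope classical_set_scope.

Set Implicit Arguments.
Unset Strict Implicit.
Unset Printing Implicit Defensive.

(** * Values of tuples of variables *)

Definition avals S (M : model S) (s : assignment M) k (xs : k.-tuple var) :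
  k.-tuple M := map_tuple (aval s) xs.

Lemma avals_eqP S (M : model S) (s s' : assignment M) k (xs ys : k.-tuple var) :
  avals s xs = avals s' ys <->
  forall i, aval s (tnth xs i) = aval s' (tnth ys i).
Proof.
split=> [eq_st i|eq_st]; last by apply: eq_from_tnth => i; rewrite !tnth_map.
by have := congr1 (fun t => tnth t i) eq_st; rewrite !tnth_map.
Qed.

Lemma avals_map S (M : model S) (s : assignment M) k T (f : T -> var)
  (ts : k.-tuple T) : avals s (map_tuple f ts) = map_tuple (aval s \o f) ts.
Proof. by apply: val_inj; rewrite /= -map_comp. Qed.

Definition var_tuple S k (xs : k.-tuple var) : k.-tuple (term S) :=
  map_tuple (@Var S) xs.

Lemma tsval_var_tuple S (M : model S) (s : assignment M) k
  (xs : k.-tuple var) : tsval s (var_tuple S xs) = avals s xs.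
Proof. by apply: val_inj; rewrite /= -map_comp. Qed.

Lemma var_tuple_fv S k (xs : k.-tuple var) :
  tuple_fv (var_tuple S xs) = [set` xs].
Proof.
apply/seteqP; split=> x /=.
  by case=> i; rewrite tnth_map /= => ->; apply: mem_tnth.
by case/tnthP=> i ->; exists i; rewrite tnth_map.
Qed.

Lemma avals_cons_eq S (M : model S) (s s' : assignment M) k x y
    (xs ys : k.-tuple var) :
  avals s [tuple of x :: xs] = avals s' [tuple of y :: ys] <->
  aval s x = aval s' y /\ avals s xs = avals s' ys.
Proof.
split=> [/(congr1 val)/= [-> eq_st]|[eq_x /(congr1 val)/= eq_st]].
  by split=> //; apply: val_inj.
by apply: val_inj; rewrite /= eq_x eq_st.
Qed.

(** * Quantifier blocks *)

(** The effect of a whole quantifier block on one assignment: old values on [xs] are forgotten, so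
    the order of [xs] and repetitions in it do not matter. *)
Definition extends_on S (M : model S) (xs : seq var) (s s' : assignment M) :=
  forall y, if y \in xs then s' y <> None else s' y = s y.

Lemma extends_on_nil S (M : model S) (s s' : assignment M) :
  extends_on [::] s s' <-> s' = s.
Proof.
split=> [ext_s|-> //]; apply: funext => y; exact: (ext_s y).
Qed.

Lemma extends_on_cons S (M : model S) x xs (s s' : assignment M) :
  extends_on (x :: xs) s s' <-> exists m, extends_on xs (upd s x m) s'.
Proof.
split=> [ext_s|[m ext_s] y]; last first.
  have := ext_s y; rewrite in_cons /upd; case: eqP => //= _.
  by case: ifP => // _ ->.
(* [s' x] is defined because [x] is in the block, so the junk default of [aval] is never reached. *)
exists (aval s' x) => y; have := ext_s y; rewrite in_cons /upd /aval.
case: eqP => [->|_] //=.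
by case: (s' x) => //= z; case: ifP.
Qed.

Lemma aval_extends_on S (M : model S) xs (s s' : assignment M) y :
  extends_on xs s s' -> y \notin xs -> aval s' y = aval s y.
Proof. by move=> /(_ y) + /negbTE y_xs; rewrite y_xs /aval => ->. Qed.

Lemma extends_on_codom S (M : model S) (I : finType) (nu : I -> var)
    (s : assignment M) (g : I -> M) : injective nu ->
  exists2 s', extends_on (codom nu) s s' & forall i, aval s' (nu i) = g i.
Proof.
move=> nu_inj.
(* The [pick] inverts [nu]; injectivity lets the values on the block be prescribed independently. *)
exists (fun y => if [pick i | nu i == y] is Some i then Some (g i) else s y).
  move=> y; case: pickP => [i /eqP <-|nu_y]; first by rewrite codom_f.
  by case: ifP => // /codomP[i y_i]; have := nu_y i; rewrite y_i eqxx.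
move=> i; rewrite /aval; case: pickP => [j /eqP/nu_inj -> //|/(_ i)].
by rewrite eqxx.
Qed.

Lemma team_sat_Alls S A (M : model S)
    (asat : set (assignment M) -> A -> Prop) xs X (p : formula S A) :
  team_sat asat X (foldr (@All S A) p xs) <->
  team_sat asat [set s' | exists2 s, X s & extends_on xs s s'] p.
Proof.
elim: xs X => [|x xs IH] X /=.
  suff -> : [set s' | exists2 s, X s & extends_on [::] s s'] = X by [].
  apply/seteqP; split=> [s' [s Xs /extends_on_nil ->] //|s Xs].
  by exists s => //; apply/extends_on_nil.
rewrite IH.
suff -> : [set s' | exists2 s, team_duplicate X x s & extends_on xs s s'] =
  [set s' | exists2 s, X s & extends_on (x :: xs) s s'] by [].
apply/seteqP; split=> [s' [_ [s [m [Xs ->]]] ext_s]|].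
  by exists s => //; apply/extends_on_cons; exists m.
move=> s' [s Xs /extends_on_cons[m ext_s]].
by exists (upd s x m) => //; exists s, m.
Qed.

(** The teams [Y] that a block of lax existential quantifiers can produce from [X]: every assignment
    keeps at least one extension, and nothing else is added. *)
Definition covers_on S (M : model S) xs (X Y : set (assignment M)) :=
  (forall s, X s -> exists2 s', Y s' & extends_on xs s s') /\
  (forall s', Y s' -> exists2 s, X s & extends_on xs s s').

Lemma team_sat_Exs S A (M : model S)
    (asat : set (assignment M) -> A -> Prop) xs X (p : formula S A) :
  team_sat asat X (foldr (@Ex S A) p xs) <->
  exists2 Y, covers_on xs X Y & team_sat asat Y p.
Proof.
elim: xs X => [|x xs IH] X /=.
  split=> [sat_p|[Y [XY YX]]].
    by exists X => //; split=> s Xs; exists s => //; apply/extends_on_nil.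
  suff -> : Y = X by [].
  apply/seteqP; split=> s.
    by case/YX=> s' Xs' /extends_on_nil ->.
  by case/XY=> s' Ys' /extends_on_nil <-.
split=> [[H H_neq0 /IH[Y [XY YX] sat_p]]|[Y [XY YX] sat_p]].
  exists Y => //; split=> [s Xs|s' /YX[_ [s [m [Xs _ ->]]] ext_s]].
    have [m Hsm] := H_neq0 s Xs.
    have [|s' Ys' ext_s] := XY (upd s x m); first by exists s, m.
    by exists s' => //; apply/extends_on_cons; exists m.
  by exists s => //; apply/extends_on_cons; exists m.
(* The choice for [x] at [s] collects all values through which some member of [Y] extends [s]. Being
   set-valued, it loses no member of [Y]. *)
exists (fun s m => exists2 s', Y s' & extends_on xs (upd s x m) s').
  by move=> s /XY[s' Ys' /extends_on_cons[m ext_s]]; exists m, s'.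
apply/IH; exists Y => //; split=> [_ [s [m [Xs [s' Ys' ext_s] ->]]]|s' Ys'].
  by exists s'.
have [s Xs /extends_on_cons[m ext_s]] := YX s' Ys'.
by exists (upd s x m) => //; exists s, m; split=> //; exists s'.
Qed.

Lemma free_vars_Alls S A (afv : A -> set var) xs (p : formula S A) D :
  free_vars afv p `<=` D `|` [set` xs] ->
  free_vars afv (foldr (@All S A) p xs) `<=` D.
Proof.
elim: xs D => [|x xs IH] D fv_p /=; first by move=> y /fv_p[].
suff fv_q : free_vars afv (foldr (@All S A) p xs) `<=` D `|` [set x].
  by move=> y [/fv_q[]].
apply: IH => y /fv_p[Dy|]; first by left; left.
by rewrite /= in_cons => /predU1P[->|xs_y]; [left; right|right].
Qed.

Lemma free_vars_Exs S A (afv : A -> set var) xs (p : formula S A) D :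
  free_vars afv p `<=` D `|` [set` xs] ->
  free_vars afv (foldr (@Ex S A) p xs) `<=` D.
Proof.
elim: xs D => [|x xs IH] D fv_p /=; first by move=> y /fv_p[].
suff fv_q : free_vars afv (foldr (@Ex S A) p xs) `<=` D `|` [set x].
  by move=> y [/fv_q[]].
apply: IH => y /fv_p[Dy|]; first by left; left.
by rewrite /= in_cons => /predU1P[->|xs_y]; [left; right|right].
Qed.

(** * Definable team properties *)

(** Abstracts over the atoms, so that one construction serves both logics. *)
Record team_logic S := TeamLogic {
  atom : Type;
  atom_fv : atom -> set var;
  atom_sat : forall M : model S, set (assignment M) -> atom -> Prop
}.

Definition ie_logic S := TeamLogic (@ie_fv S) (@ie_sat S).
Definition ind_logic S := TeamLogic (@ind_fv S) (@ind_sat S).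

Definition definable S (L : team_logic S) (D : set var)
    (Q : forall M : model S, set (assignment M) -> Prop) :=
  exists2 p : formula S (atom L), free_vars (@atom_fv S L) p `<=` D &
    forall M X, team_sat (@atom_sat S L M) X p <-> Q M X.

(** Properties checked one assignment at a time. Disjunction acts on them as the classical
    connective, which is why the team atoms are kept outside it. *)
Definition flat_definable S (L : team_logic S) D
    (P : forall M : model S, assignment M -> Prop) :=
  definable L D (fun M X => forall s, X s -> P M s).

Lemma definable_ext S (L : team_logic S) D
    (Q Q' : forall M : model S, set (assignment M) -> Prop) :
  (forall M X, Q M X <-> Q' M X) -> definable L D Q -> definable L D Q'.
Proof. by move=> QQ' [p fv_p sat_p]; exists p => // M X; rewrite sat_p. Qed.

Lemma definable_and S (L : team_logic S) D
    (Q Q' : forall M : model S, set (assignment M) -> Prop) :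
  definable L D Q -> definable L D Q' ->
  definable L D (fun M X => Q M X /\ Q' M X).
Proof.
move=> [p fv_p sat_p] [q fv_q sat_q]; exists (And p q) => [x [/fv_p|/fv_q]//|].
by move=> M X /=; rewrite sat_p sat_q.
Qed.

Lemma definable_atom S (L : team_logic S) D (a : atom L) :
  atom_fv a `<=` D -> definable L D (fun M X => atom_sat X a).
Proof. by move=> fv_a; exists (Atom S a). Qed.

Lemma flat_ext S (L : team_logic S) D
    (P P' : forall M : model S, assignment M -> Prop) :
  (forall M s, P M s <-> P' M s) ->
  flat_definable L D P -> flat_definable L D P'.
Proof.
move=> PP'; apply: definable_ext => M X.
by split=> PX s /PX /PP'.
Qed.

Lemma flat_eq S (L : team_logic S) (D : set var) x y : D x -> D y ->
  flat_definable L D (fun M s => aval s x = aval s y).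
Proof.
by move=> Dx Dy; exists (Lit _ (Eq (Var S x) (Var S y))) => // z [] /= ->.
Qed.

Lemma flat_neq S (L : team_logic S) (D : set var) x y : D x -> D y ->
  flat_definable L D (fun M s => aval s x <> aval s y).
Proof.
by move=> Dx Dy; exists (Lit _ (NEq (Var S x) (Var S y))) => // z [] /= ->.
Qed.

Lemma flat_and S (L : team_logic S) D
    (P P' : forall M : model S, assignment M -> Prop) :
  flat_definable L D P -> flat_definable L D P' ->
  flat_definable L D (fun M s => P M s /\ P' M s).
Proof.
move=> defP defP'; apply: definable_ext (definable_and defP defP') => M X.
by split=> [[PX P'X] s Xs|PX]; [split; [apply: PX|apply: P'X]|split=> s /PX[]].
Qed.

Lemma flat_or S (L : team_logic S) D
    (P P' : forall M : model S, assignment M -> Prop) :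
  flat_definable L D P -> flat_definable L D P' ->
  flat_definable L D (fun M s => P M s \/ P' M s).
Proof.
move=> [p fv_p sat_p] [q fv_q sat_q]; exists (Or p q) => [x [/fv_p|/fv_q]//|].
move=> M X; split=> /= [[Y [Z [-> /sat_p PY /sat_q P'Z]]] s|PX].
  by case=> [/PY|/P'Z]; [left|right].
(* The team is split according to which disjunct each assignment satisfies. *)
exists (X `&` [set s | P M s]), (X `&` [set s | P' M s]); split.
- rewrite -setIUr; apply/esym/setIidPl; exact: PX.
- by apply/sat_p => s [].
- by apply/sat_q => s [].
Qed.

(** Truth is rendered by [x = x], with [x] taken from [D] to respect the bound on free variables; it
    supplies the empty conjunctions below. *)
Lemma flat_true S (L : team_logic S) (D : set var) x : D x ->
  flat_definable L D (fun M s => True).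
Proof. by move=> Dx; apply: flat_ext (flat_eq _ Dx Dx). Qed.

Lemma flat_forall S (L : team_logic S) (D : set var) x (I : finType)
    (P : I -> forall M : model S, assignment M -> Prop) : D x ->
  (forall i, flat_definable L D (P i)) ->
  flat_definable L D (fun M s => forall i, P i M s).
Proof.
move=> Dx defP.
suff: flat_definable L D (fun M s => forall i, i \in enum I -> P i M s).
  by apply: flat_ext => M s; split=> Ps i; have := Ps i;
    rewrite mem_enum //; apply.
elim: (enum I) => [|i e IH]; first by apply: flat_ext (flat_true _ Dx).
apply: flat_ext (flat_and (defP i) IH) => M s; split=> [[Pi Pe] j|Pe].
  by rewrite in_cons => /predU1P[->|/Pe].
split=> [|j e_j]; apply: Pe; first exact: mem_head.
by rewrite in_cons e_j orbT.
Qed.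

Lemma flat_exists S (L : team_logic S) (D : set var) x (I : finType)
    (P : I -> forall M : model S, assignment M -> Prop) : D x ->
  (forall i, flat_definable L D (P i)) ->
  flat_definable L D (fun M s => exists i, P i M s).
Proof.
move=> Dx defP.
suff: flat_definable L D (fun M s => exists2 i, i \in enum I & P i M s).
  apply: flat_ext => M s; split=> [[i _ Pi]|[i Pi]]; exists i => //.
  by rewrite mem_enum.
elim: (enum I) => [|i e IH].
  (* The empty disjunction is rendered by [x <> x]. *)
  by apply: flat_ext (flat_neq _ Dx Dx) => M s; split=> // -[].
apply: flat_ext (flat_or (defP i) IH) => M s; split=> [[Pi|[j e_j Pj]]|[j]].
- by exists i => //; apply: mem_head.
- by exists j => //; rewrite in_cons e_j orbT.
- by rewrite in_cons => /predU1P[->|e_j] Pj; [left|right; exists j].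
Qed.

Lemma definable_forall S (L : team_logic S) (D : set var) x (I : finType)
    (Q : I -> forall M : model S, set (assignment M) -> Prop) : D x ->
  (forall i, definable L D (Q i)) ->
  definable L D (fun M X => forall i, Q i M X).
Proof.
move=> Dx defQ.
suff: definable L D (fun M X => forall i, i \in enum I -> Q i M X).
  by apply: definable_ext => M X; split=> QX i; have := QX i;
    rewrite mem_enum //; apply.
elim: (enum I) => [|i e IH]; first by apply: definable_ext (flat_true _ Dx).
apply: definable_ext (definable_and (defQ i) IH) => M X.
split=> [[Qi Qe] j|Qe]; first by rewrite in_cons => /predU1P[->|/Qe].
split=> [|j e_j]; apply: Qe; first exact: mem_head.
by rewrite in_cons e_j orbT.
Qed.

Lemma flat_tuple_eq S (L : team_logic S) (D : set var) x k
    (xs ys : k.-tuple var) : D x -> [set` xs] `<=` D -> [set` ys] `<=` D ->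
  flat_definable L D (fun M s => avals s xs = avals s ys).
Proof.
move=> Dx Dxs Dys; apply: flat_ext (flat_forall Dx _) => [M s|i].
  exact: iff_sym (avals_eqP _ _ _ _).
by apply: flat_eq; [apply: Dxs|apply: Dys]; apply: mem_tnth.
Qed.

Lemma flat_tuple_neq S (L : team_logic S) (D : set var) x k
    (xs ys : k.-tuple var) : D x -> [set` xs] `<=` D -> [set` ys] `<=` D ->
  flat_definable L D (fun M s => avals s xs <> avals s ys).
Proof.
move=> Dx Dxs Dys.
have defP i : flat_definable L D
    (fun M s => aval s (tnth xs i) <> aval s (tnth ys i)).
  by apply: flat_neq; [apply: Dxs|apply: Dys]; apply: mem_tnth.
apply: flat_ext (flat_exists Dx defP) => M s.
split=> [[i neq_i] /avals_eqP/(_ i)/neq_i//|neq_s].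
apply: contrapT => all_eq; apply/neq_s/avals_eqP => i.
by apply: contrapT => neq_i; apply: all_eq; exists i.
Qed.

(* [h] provides, for each row of the relation of [v] and each choice of values
   of the universal variables, values of the existential ones. *)
Lemma definable_prenex S (L : team_logic S) (U E : finType) r
    (v : r.-tuple var) (nu : U + E -> var)
    (Q : forall M : model S, set (assignment M) -> Prop) :
  injective nu -> (forall k, nu k \notin v) ->
  definable L ([set` v] `|` range nu) Q ->
  exists2 p : formula S (atom L), free_vars (@atom_fv S L) p `<=` [set` v] &
  forall M (X : set (assignment M)),
    (team_sat (@atom_sat S L M) X p -> exists Y,
      [/\ Q M Y,
          forall t g, team_rel X v t -> exists s,
            [/\ Y s, avals s v = t & forall i, aval s (nu (inl i)) = g i] &
          forall s, Y s -> team_rel X v (avals s v)]) /\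
    (forall h : r.-tuple M -> (U -> M) -> E -> M,
      let graph s t g := [/\ avals s v = t,
        forall i, aval s (nu (inl i)) = g i &
        forall j, aval s (nu (inr j)) = h t g j] in
      (forall Y,
        (forall t g, team_rel X v t -> exists2 s, Y s & graph s t g) ->
        (forall s, Y s -> exists t g, team_rel X v t /\ graph s t g) ->
        Q M Y) ->
      team_sat (@atom_sat S L M) X p).
Proof.
move=> nu_inj nu_v [q fv_q sat_q].
have nul_inj : injective (nu \o inl) by move=> i j /nu_inj[].
have nur_inj : injective (nu \o inr) by move=> i j /nu_inj[].
have nul_r i : nu (inl i) \notin codom (nu \o inr).
  by apply/codomP => -[j /nu_inj].
have v_cod (I : finType) (f : I -> U + E) i : tnth v i \notin codom (nu \o f).
  by apply/codomP => -[k v_k]; have := nu_v (f k); rewrite -[nu _]v_k mem_tnth.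
have avals_ext (I : finType) (f : I -> U + E) (M : model S)
    (s s' : assignment M) :
    extends_on (codom (nu \o f)) s s' -> avals s' v = avals s v.
  by move=> ext_s; apply/avals_eqP => i; apply: aval_extends_on ext_s _.
(* The [inl] variables form the universal block, the [inr] variables the existential one, and [q] is
   the matrix. *)
exists (foldr (@All _ _) (foldr (@Ex _ _) q (codom (nu \o inr)))
  (codom (nu \o inl))).
  apply: free_vars_Alls; apply: free_vars_Exs => x /fv_q[v_x|[[i|j] _ <-]].
  - by left; left.
  - by left; right; apply: codom_f.
  - by right; apply: codom_f.
move=> M X; split.
  move=> /team_sat_Alls/team_sat_Exs[Y [XY YX] /sat_q QY].
  exists Y; split=> // [t g [s Xs ->]|s' /YX[s1 [s Xs ext_s] ext_s1]].
    have [s1 ext_s g_s1] := extends_on_codom s g nul_inj.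
    have [|s' Ys' ext_s1] := XY s1; first by exists s.
    exists s'; split=> // [|i].
      by rewrite (avals_ext _ _ _ _ _ ext_s1) (avals_ext _ _ _ _ _ ext_s).
    by rewrite (aval_extends_on ext_s1) //; apply: g_s1.
  exists s => //.
  by rewrite (avals_ext _ _ _ _ _ ext_s1) (avals_ext _ _ _ _ _ ext_s).
move=> h graph hQ; apply/team_sat_Alls/team_sat_Exs.
(* The witnessing team: the existential variables follow [h], evaluated at the row of [v] and the
   universal values. *)
exists [set s' | exists s s1 g, [/\ X s, extends_on (codom (nu \o inl)) s s1,
  extends_on (codom (nu \o inr)) s1 s' & graph s' (avals s v) g]].
  split=> [s1 [s Xs ext_s]|s' [s [s1 [g [Xs ext_s ext_s1 _]]]]]; last first.
    by exists s1 => //; exists s.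
  pose g i := aval s1 (nu (inl i)).
  have [s' ext_s1 h_s'] := extends_on_codom s1 (h (avals s v) g) nur_inj.
  exists s' => //; exists s, s1, g; split=> //; split=> // [|i].
    by rewrite (avals_ext _ _ _ _ _ ext_s1) (avals_ext _ _ _ _ _ ext_s).
  by rewrite (aval_extends_on ext_s1).
apply/sat_q/hQ => [t g [s Xs ->]|s' [s [s1 [g [Xs _ _ graph_s']]]]]; last first.
  by exists (avals s v), g; split=> //; exists s.
have [s1 ext_s g_s1] := extends_on_codom s g nul_inj.
have [s' ext_s1 h_s'] := extends_on_codom s1 (h (avals s v) g) nur_inj.
have graph_s' : graph s' (avals s v) g.
  split=> // [|i].
    by rewrite (avals_ext _ _ _ _ _ ext_s1) (avals_ext _ _ _ _ _ ext_s).
  by rewrite (aval_extends_on ext_s1) //; apply: g_s1.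
by exists s' => //; exists s, s1, g.
Qed.

(** * The two atoms needed for a dependency *)

(* Here [R] is [team_rel Y v].  The atom [flag c p y v] makes [p = c] a
   certificate that [y] is outside [R], provided that [y = v] excludes [p = c];
   [member a c u v] certifies that [u] is in [R], provided that [a = c] forces
   [u = v].  Inclusion logic satisfies the second atom by [u] included in [v]
   without the proviso; in independence logic, the independence of [u] from
   [a, c] transports each value of [u] to an assignment where [a = c]. *)
Record certificates S (L : team_logic S) r := Certificates {
  flag : var -> var -> r.-tuple var -> r.-tuple var -> atom L;
  member : var -> var -> r.-tuple var -> r.-tuple var -> atom L;
  flag_fv c p (y v : r.-tuple var) (D : set var) : D c -> D p ->
    [set` y] `<=` D -> [set` v] `<=` D -> atom_fv (flag c p y v) `<=` D;
  member_fv a c (u v : r.-tuple var) (D : set var) : D a -> D c ->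
    [set` u] `<=` D -> [set` v] `<=` D -> atom_fv (member a c u v) `<=` D;
  flag_sound (M : model S) (Y : set (assignment M)) c p y v :
    (forall s t, Y s -> team_rel Y v t -> exists s',
       [/\ Y s', avals s' v = t, avals s' y = t & aval s' c = aval s c]) ->
    (forall s, Y s -> avals s y <> avals s v \/ aval s p <> aval s c) ->
    atom_sat Y (flag c p y v) ->
    forall s, Y s -> aval s p = aval s c -> ~ team_rel Y v (avals s y);
  flag_complete (M : model S) (Y : set (assignment M)) c p y v :
    (forall s s', Y s -> Y s' -> aval s c = aval s' c ->
       avals s y = avals s' y -> aval s p = aval s' p) ->
    (forall s, Y s -> aval s p = aval s c -> ~ team_rel Y v (avals s y)) ->
    atom_sat Y (flag c p y v);
  member_sound (M : model S) (Y : set (assignment M)) a c u v :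
    (forall s, Y s -> aval s a <> aval s c \/ avals s u = avals s v) ->
    (exists2 s, Y s & aval s a = aval s c) ->
    atom_sat Y (member a c u v) ->
    forall s, Y s -> team_rel Y v (avals s u);
  member_complete (M : model S) (Y : set (assignment M)) a c u v :
    (forall s, Y s -> team_rel Y v (avals s u)) ->
    (forall s s', Y s -> Y s' -> exists s'',
       [/\ Y s'', avals s'' u = avals s v, aval s'' a = aval s' a &
           aval s'' c = aval s' c]) ->
    atom_sat Y (member a c u v)
}.

Lemma cons_tuple_sub k x (xs : k.-tuple var) (D : set var) : D x ->
  [set` xs] `<=` D -> [set` [tuple of x :: xs]] `<=` D.
Proof. by move=> Dx Dxs y /=; rewrite in_cons => /predU1P[->|/Dxs]. Qed.

(** If [p = c] and [y] were a row of the relation, an assignment with that row as [v] and the same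
    [c] would violate [p c y | c c v]; the repeated [c] synchronizes the two assignments. *)
Lemma ie_certificates S r : certificates (ie_logic S) r.
Proof.
unshelve eexists.
- exact: (fun c p y v => Exclusion (var_tuple S [tuple of p :: c :: y])
                           (var_tuple S [tuple of c :: c :: v])).
- exact: (fun a c u v => Inclusion (var_tuple S u) (var_tuple S v)).
- move=> c p y v D Dc Dp Dy Dv /=; rewrite !var_tuple_fv => x [].
    by apply: cons_tuple_sub => //; apply: cons_tuple_sub.
  by apply: cons_tuple_sub => //; apply: cons_tuple_sub.
- by move=> a c u v D _ _ Du Dv /=; rewrite !var_tuple_fv => x [/Du|/Dv].
- move=> M Y c p y v full _ sat_Y s Ys p_c Ry.
  have [s' [Ys' v_s' _ c_s']] := full s _ Ys Ry.
  apply: (sat_Y s s' Ys Ys'); rewrite !tsval_var_tuple.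
  by apply/avals_cons_eq; split; [|apply/avals_cons_eq]; rewrite ?p_c ?c_s'.
- move=> M Y c p y v _ Y_flag s s' Ys Ys'; rewrite !tsval_var_tuple.
  move=> /avals_cons_eq[p_c /avals_cons_eq[c_c y_v]].
  by apply: (Y_flag s Ys); [rewrite p_c|exists s'].
- move=> M Y a c u v _ _ sat_Y s /sat_Y[s' Ys'].
  by rewrite !tsval_var_tuple => ->; exists s'.
- move=> M Y a c u v Yu _ s /Yu[s' Ys' u_v].
  by exists s' => //; rewrite !tsval_var_tuple.
Qed.

(** Independence of [p] from itself given [c y] is the dependence atom: [p] is a function of [c y].
    If [y] is a row, this function can be read off where [y = v], and there [p <> c]. *)
Lemma ind_certificates S r : certificates (ind_logic S) r.
Proof.
unshelve eexists.
- exact: (fun c p y v => Independence (var_tuple S [tuple p])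
    (var_tuple S [tuple of c :: y]) (var_tuple S [tuple p])).
- exact: (fun a c u v => Independence (var_tuple S u) (var_tuple S [tuple])
    (var_tuple S [tuple a; c])).
- move=> c p y v D Dc Dp Dy Dv /=; rewrite !var_tuple_fv => x [[]|].
  + by apply: cons_tuple_sub.
  + by apply: cons_tuple_sub.
  + by apply: cons_tuple_sub.
- move=> a c u v D Da Dc Du Dv /=; rewrite !var_tuple_fv => x [[/Du|]//|].
  by apply: cons_tuple_sub => //; apply: cons_tuple_sub.
- move=> M Y c p y v full Y_flag sat_Y s Ys p_c Ry.
  have [s' [Ys' v_s' y_s' c_s']] := full s _ Ys Ry.
  have [] := sat_Y s s' Ys Ys'.
    by rewrite !tsval_var_tuple; apply/avals_cons_eq.
  move=> s'' _; rewrite !tsval_var_tuple => -[[_ /avals_cons_eq[p_s _]]].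
  move=> [_ /avals_cons_eq[p_s' _]].
  have [] := Y_flag s' Ys'; first by rewrite y_s' v_s'.
  by apply; rewrite -p_s' p_s p_c c_s'.
- move=> M Y c p y v Y_dep _ s s' Ys Ys'; rewrite !tsval_var_tuple.
  move=> cy_s; exists s => //; rewrite !tsval_var_tuple; do 2!split=> //.
  have /avals_cons_eq[c_s y_s] := cy_s.
  by apply/avals_cons_eq; split; [apply: Y_dep|apply: val_inj].
(* Independence joins the [u] of [s] with the [a c] of [s0]; in the resulting assignment [a = c],
   hence [u = v]. *)
- move=> M Y a c u v Y_uv [s0 Ys0 a_c] sat_Y s Ys.
  have [] := sat_Y s s0 Ys Ys0; first by apply: val_inj.
  move=> s' Ys'; rewrite !tsval_var_tuple => -[[_ u_s'] [_]].
  move=> /avals_cons_eq[a_s' /avals_cons_eq[c_s' _]].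
  have [|u_v] := Y_uv s' Ys'; first by rewrite a_s' c_s'.
  by exists s' => //; rewrite -u_s'.
- move=> M Y a c u v Yu Y_full s s' Ys Ys' _.
  have [s1 Ys1 u_s] := Yu s Ys.
  have [s'' [Ys'' u_s'' a_s'' c_s'']] := Y_full s1 s' Ys1 Ys'.
  exists s'' => //; rewrite !tsval_var_tuple.
  split; split; try by apply: val_inj.
    by rewrite u_s''.
  apply/avals_cons_eq; split=> //; apply/avals_cons_eq; split=> //.
  exact: val_inj.
Qed.

(** * Dependencies *)

(** Access by position, so that each atom of a conjunction can own the auxiliary variables indexed
    by its position. *)
Lemma conj_sat_tnth r V T (R : set (r.-tuple T)) (e : V -> T)
    (c : seq (dep_atom r V)) :
  conj_sat R e c <-> forall i, dep_atom_sat R e (tnth (in_tuple c) i).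
Proof.
elim: c => [|d c IH] /=; first by split=> // _ [].
have tnth_lift i : tnth (in_tuple (d :: c)) (lift ord0 i) = tnth (in_tuple c) i.
  by rewrite !(tnth_nth d).
split=> [[sat_d /IH sat_c] i|sat_c].
  by case: (unliftP ord0 i) => [j|] ->; rewrite ?tnth_lift.
split; first exact: (sat_c ord0).
by apply/IH => i; rewrite -tnth_lift.
Qed.

(** Supplies a row when the team is not assumed nonempty. *)
Lemma conj_sat_relational r V T (R : set (r.-tuple T)) (e : V -> T)
    (c : seq (dep_atom r V)) :
  has (@is_DRel r V) c -> conj_sat R e c -> R !=set0.
Proof.
elim: c => //= -[ts|l ts us] c IH /=.
  by move=> _ [Rts _]; exists (map_tuple e ts).
by move=> c_rel [_]; apply: IH.
Qed.

Lemma fresh_vars (K : countType) (v : seq var) :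
  exists2 nu : K -> var, injective nu & forall k, nu k \notin v.
Proof.
(* Codes shifted above the largest variable of [v]. *)
exists (fun k => (\max_(x <- v) x).+1 + pickle k).
  by move=> k l /addnI/(pcan_inj pickleK).
move=> k; apply/negP => v_k.
by have := @leq_bigmax_seq _ v xpredT id _ v_k isT;
  rewrite /= leqNgt addSn ltnS leq_addr.
Qed.

Lemma tgd_definable S (L : team_logic S) r (C : certificates L r)
    (v : r.-tuple var) n k (prem : seq (dep_atom r 'I_n))
    (concl : seq (dep_atom r ('I_n + 'I_k))) :
  exists2 p : formula S (atom L), free_vars (@atom_fv S L) p `<=` [set` v] &
    forall (M : model S) (X : set (assignment M)),
      X !=set0 \/ has (@is_DRel r _) prem ->
      team_sat (@atom_sat S L M) X p <->
      dep_sat (team_rel X v) (TGD prem concl).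
Proof.
set m := size prem; set l := size concl.
(* [U] indexes the universal variables [c], [a], [b], the [x] and the tuples [y]; [E] indexes the
   flags [p], the [z] and the tuples [u]. Equality atoms also receive auxiliary variables, to keep
   the indexing uniform. *)
pose U := (option bool + 'I_n + 'I_m * 'I_r)%type.
pose E := ('I_m + 'I_k + 'I_l * 'I_r)%type.
have [nu nu_inj nu_v] := fresh_vars (U + E)%type v.
pose c := nu (inl (inl (inl None))).
pose a := nu (inl (inl (inl (Some true)))).
pose b := nu (inl (inl (inl (Some false)))).
pose x i := nu (inl (inl (inr i))).
pose y i := [tuple nu (inl (inr (i, j))) | j < r].
pose p i := nu (inr (inl (inl i))).
pose z i := nu (inr (inl (inr i))).
pose u j := [tuple nu (inr (inr (j, i))) | i < r].
pose xz w := match w with inl i => x i | inr j => z j end.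
pose D := [set` v] `|` range nu.
have Dnu w : D (nu w) by right; exists w.
have Dc : D c by exact: Dnu.
have Dv : [set` v] `<=` D by move=> w; left.
have Dy i : [set` y i] `<=` D by move=> w /= /mapP[j _ ->]; exact: Dnu.
have Du j : [set` u j] `<=` D by move=> w /= /mapP[i _ ->]; exact: Dnu.
have Dx q (ts : q.-tuple 'I_n) : [set` map_tuple x ts] `<=` D.
  move=> w /= /mapP[i _ ->]; exact: Dnu.
have Dxz q (ts : q.-tuple ('I_n + 'I_k)) : [set` map_tuple xz ts] `<=` D.
  move=> w /= /mapP[[i|i] _ ->]; exact: Dnu.
pose premise_fails i (M : model S) (s : assignment M) :=
  match tnth (in_tuple prem) i with
  | DRel ts => avals s (y i) <> avals s (map_tuple x ts) \/
               aval s (p i) = aval s c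
  | DEq _ ts us => avals s (map_tuple x ts) <> avals s (map_tuple x us)
  end.
pose conclusion_holds j (M : model S) (s : assignment M) :=
  match tnth (in_tuple concl) j with
  | DRel ts => avals s (u j) = avals s (map_tuple xz ts)
  | DEq _ ts us => avals s (map_tuple xz ts) = avals s (map_tuple xz us)
  end.
pose body (M : model S) (s : assignment M) :=
  [/\ forall i, avals s (y i) <> avals s v \/ aval s (p i) <> aval s c,
      forall j, aval s a <> aval s c \/ avals s (u j) = avals s v &
      (exists i, premise_fails i M s) \/
      (aval s a = aval s c \/ aval s b <> aval s c) \/
      forall j, conclusion_holds j M s].
pose Q (M : model S) (Y : set (assignment M)) :=
  [/\ forall i, atom_sat Y (flag C c (p i) (y i) v),
      forall j, atom_sat Y (member C a c (u j) v) &
      forall s, Y s -> body M s].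
have defQ : definable L D Q.
  have def_flag : definable L D
      (fun M Y => forall i, atom_sat Y (flag C c (p i) (y i) v)).
    apply: (definable_forall Dc) => i.
    apply: (@definable_atom S L D (flag C c (p i) (y i) v)).
    exact: (flag_fv Dc (Dnu _) (Dy i) Dv).
  have def_member : definable L D
      (fun M Y => forall j, atom_sat Y (member C a c (u j) v)).
    apply: (definable_forall Dc) => j.
    apply: (@definable_atom S L D (member C a c (u j) v)).
    exact: (member_fv (Dnu _) Dc (Du j) Dv).
  have flat_body : flat_definable L D body.
    have flat1 : flat_definable L D (fun M s => forall i,
        avals s (y i) <> avals s v \/ aval s (p i) <> aval s c).
      apply: (flat_forall Dc) => i; apply: flat_or.
        exact: (flat_tuple_neq L Dc (Dy i) Dv).
      exact: (flat_neq L (Dnu _) Dc).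
    have flat2 : flat_definable L D (fun M s => forall j,
        aval s a <> aval s c \/ avals s (u j) = avals s v).
      apply: (flat_forall Dc) => j; apply: flat_or.
        exact: (flat_neq L (Dnu _) Dc).
      exact: (flat_tuple_eq L Dc (Du j) Dv).
    have flat3 : flat_definable L D (fun M s => exists i, premise_fails i M s).
      apply: (flat_exists Dc) => i.
      rewrite /premise_fails; case: (tnth _ i) => [ts|q ts us].
        apply: flat_or; last exact: (flat_eq L (Dnu _) Dc).
        exact: (flat_tuple_neq L Dc (Dy i) (Dx _ ts)).
      exact: (flat_tuple_neq L Dc (Dx _ ts) (Dx _ us)).
    have flat4 : flat_definable L D
        (fun M s => forall j, conclusion_holds j M s).
      apply: (flat_forall Dc) => j.
      rewrite /conclusion_holds; case: (tnth _ j) => [ts|q ts us].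
        exact: (flat_tuple_eq L Dc (Du j) (Dxz _ ts)).
      exact: (flat_tuple_eq L Dc (Dxz _ ts) (Dxz _ us)).
    have flat5 : flat_definable L D
        (fun M s => aval s a = aval s c \/ aval s b <> aval s c).
      apply: flat_or; first exact: (flat_eq L (Dnu _) Dc).
      exact: (flat_neq L (Dnu _) Dc).
    apply: flat_ext (flat_and flat1
      (flat_and flat2 (flat_or flat3 (flat_or flat5 flat4)))) => M s.
    by split=> [[? []]|[]].
  apply: definable_ext (definable_and def_flag
    (definable_and def_member flat_body)) => M Y.
  by split=> [[? []]|[]].
have [phi fv_phi sat_phi] := definable_prenex nu_inj nu_v defQ.
exists phi => // M X X_rel.
have [sound complete] := sat_phi M X.
have [m0 [m1 m01]] := two_elements M.
have avals_y (s : assignment M) g i :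
    (forall w, aval s (nu (inl w)) = g w) ->
    avals s (y i) = [tuple g (inr (i, j)) | j < r].
  by move=> g_s; apply: eq_from_tnth => j; rewrite !tnth_map !tnth_ord_tuple.
split=> [/sound[Y [[flagY memberY bodyY] XY YX]] e prem_e|dep].
  have YE : team_rel Y v = team_rel X v.
    apply/seteqP; split=> [_ [s Ys ->]|t Xt]; first exact: YX.
    by have [s [Ys <- _]] := XY t (fun=> m0) Xt; exists s.
  have [t0 Xt0] : team_rel X v !=set0.
    case: X_rel => [[s Xs]|prem_rel].
      by exists (avals s v); exists s.
    exact: conj_sat_relational prem_rel prem_e.
  (* Each [y i] is set to the row named by its premise atom, with [t0] as filler for equalities. *)
  pose row i := if tnth (in_tuple prem) i is DRel ts
    then map_tuple e ts else t0.
  (* Taking [b = c] and [a <> c] closes the escape clause, so the conclusion must hold once every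
     premise atom does. *)
  pose g (w : U) : M := match w with
    | inl (inl None) | inl (inl (Some false)) => m0
    | inl (inl (Some true)) => m1
    | inl (inr i) => e i
    | inr (i, j) => tnth (row i) j
    end.
  have [s [Ys _ g_s]] := XY t0 g Xt0.
  have e_s q (ts : q.-tuple 'I_n) : avals s (map_tuple x ts) = map_tuple e ts.
    by rewrite avals_map; apply: eq_from_tnth => i; rewrite !tnth_map /= g_s.
  exists (aval s \o z); apply/conj_sat_tnth => j.
  have xz_s q (ts : q.-tuple ('I_n + 'I_k)) :
      avals s (map_tuple xz ts) = map_tuple (sum_env e (aval s \o z)) ts.
    rewrite avals_map; apply: eq_from_tnth => i; rewrite !tnth_map /=.
    by case: (tnth ts i) => w //=; rewrite g_s.
  have [_ _ [[i fail_i]|[[|]|/(_ j)]]] := bodyY s Ys.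
  - have := proj1 (conj_sat_tnth _ _ _) prem_e i.
    move: fail_i; rewrite /premise_fails.
    have := avals_y s g i g_s; rewrite /= /row.
    case: (tnth _ i) => [ts|q ts us] y_s /=; last by rewrite !e_s.
    have {}y_s : avals s (y i) = map_tuple e ts.
      rewrite y_s; apply: eq_from_tnth => j'.
      by rewrite tnth_map tnth_ord_tuple.
    rewrite e_s y_s => -[//|p_c] R_e.
    have [] := flag_sound _ _ (flagY i) Ys p_c; last by rewrite YE y_s.
      move=> s' t Ys' Yt.
      (* Every [y] tuple is set to the row [t] itself, and [c] keeps its value at [s']; the
         remaining universal values are arbitrary. *)
      pose g' (w : U) : M :=
        if w is inr (_, j') then tnth t j' else aval s' c.
      have [|s'' [Ys'' v_s'' g_s'']] := XY t g'; first by rewrite -YE.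
      exists s''; split=> //; last by rewrite g_s''.
      rewrite (avals_y _ _ _ g_s''); apply: eq_from_tnth => j'.
      by rewrite tnth_map tnth_ord_tuple.
    by move=> s' /bodyY[].
  - by rewrite !g_s => /esym/m01.
  - by rewrite !g_s.
  (* Constant universal values give the assignment with [a = c] required for soundness of
     [member]. *)
  have [s0 [Ys0 _ g_s0]] := XY t0 (fun=> m0) Xt0.
  have u_Y : team_rel X v (avals s (u j)).
    rewrite -YE; apply: (member_sound _ _ (memberY j)) => //.
      by move=> s' /bodyY[].
    by exists s0 => //; rewrite !g_s0.
  rewrite /conclusion_holds; case: (tnth _ j) => [ts|q ts us] /=.
    by rewrite -xz_s => <-.
  by rewrite !xz_s.
(* Conversely, the existential values are defined explicitly. A map without fixed points, available
   since there are two elements, supplies values different from [c]. *)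
have [other other_neq] : {other : M -> M | forall w, other w <> w}.
  have /choice[f f_neq] : forall w : M, exists w', w' <> w.
    move=> w; have [w0|w_m0] := pselect (w = m0).
      by exists m1; rewrite w0 => /esym.
    by exists m0 => /esym.
  by exists f.
have /choice[F F_dep] : forall e : 'I_n -> M, exists f : 'I_k -> M,
    conj_sat (team_rel X v) e prem ->
    conj_sat (team_rel X v) (sum_env e f) concl.
  move=> e; have [/dep[f f_e]|no_e] := pselect (conj_sat (team_rel X v) e prem).
    by exists f.
  by exists (fun=> m0).
pose env (g : U -> M) i := g (inl (inr i)).
pose gc (g : U -> M) := g (inl (inl None)).
pose ga (g : U -> M) := g (inl (inl (Some true))).
pose gb (g : U -> M) := g (inl (inl (Some false))).
pose gy (g : U -> M) i := [tuple g (inr (i, j)) | j < r].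
(* The universal values at which no escape applies and the premise holds, so that the conclusion
   must be witnessed. *)
pose active g :=
  [/\ ga g <> gc g, gb g = gc g & conj_sat (team_rel X v) (env g) prem].
(* When active, [u j] stores the row required by the conclusion; otherwise it copies the current row
   of [v], as it must when [a = c]. *)
pose urow t g j :=
  if `[< active g >] then
    if tnth (in_tuple concl) j is DRel ts
    then map_tuple (sum_env (env g) (F (env g))) ts else t
  else t.
(* The flag equals [c] exactly when [y i] is outside the relation, so it depends on [c] and [y i]
   alone. *)
pose h t g (w : E) : M := match w with
  | inl (inl i) => if `[< team_rel X v (gy g i) >] then other (gc g) else gc g
  | inl (inr i) => F (env g) i
  | inr (j, i) => tnth (urow t g j) i
  end.
apply: (complete h) => Y XY YX.
have YE : team_rel Y v = team_rel X v.
  apply/seteqP; split=> [_ [s /YX[t [g [Xt [v_s _ _]]]] ->]|t Xt].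
    by rewrite -[map_tuple _ _]/(avals s v) v_s.
  by have [s Ys [<- _ _]] := XY t (fun=> m0) Xt; exists s.
have avals_u (s : assignment M) t g j :
    (forall w, aval s (nu (inr w)) = h t g w) -> avals s (u j) = urow t g j.
  move=> h_s; apply: eq_from_tnth => i.
  by rewrite !tnth_map tnth_ord_tuple h_s.
have urow_X t g j : team_rel X v t -> team_rel X v (urow t g j).
  move=> Xt; rewrite /urow; case: asboolP => // -[_ _ /F_dep].
  by move=> /conj_sat_tnth/(_ j); case: (tnth _ j).
split=> [i|j|s /YX[t [g [Xt [v_s g_s h_s]]]]].
- apply: flag_complete => [s s' /YX[t [g [_ [_ g_s h_s]]]]|s].
    move=> /YX[t' [g' [_ [_ g_s' h_s']]]].
    rewrite !(avals_y _ _ _ g_s) !(avals_y _ _ _ g_s') !g_s !g_s' !h_s !h_s' /=.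
    by rewrite -/(gc g) -/(gc g') -/(gy g i) -/(gy g' i) => -> ->.
  move=> /YX[t [g [_ [_ g_s h_s]]]]; rewrite YE (avals_y _ _ _ g_s) g_s h_s /=.
  by rewrite -/(gy g i); case: asboolP => // _ /other_neq.
- apply: member_complete => [s|s s'].
    move=> /YX[t [g [Xt [_ _ h_s]]]].
    by rewrite YE (avals_u _ _ _ _ h_s); apply: urow_X.
  move=> /YX[t [g [Xt [v_s _ _]]]] /YX[t' [g' [_ [_ g_s' _]]]].
  (* Only [b] is changed, to differ from [c]. This deactivates the assignment, so [u j] becomes the
     chosen row while [a] and [c] are kept. *)
  pose g'' (w : U) : M := match w with
    | inl (inl (Some false)) => other (gc g')
    | _ => g' w end.
  have [s'' Ys'' [v_s'' g_s'' h_s'']] := XY t g'' Xt.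
  exists s''; split=> //; rewrite ?g_s'' ?g_s' //.
  rewrite (avals_u _ _ _ _ h_s'') v_s /urow; case: asboolP => //.
  by case=> _ /other_neq.
have x_s q (ts : q.-tuple 'I_n) :
    avals s (map_tuple x ts) = map_tuple (env g) ts.
  by rewrite avals_map; apply: eq_from_tnth => i; rewrite !tnth_map /= g_s.
have xz_s q (ts : q.-tuple ('I_n + 'I_k)) :
    avals s (map_tuple xz ts) = map_tuple (sum_env (env g) (F (env g))) ts.
  rewrite avals_map; apply: eq_from_tnth => i; rewrite !tnth_map /=.
  by case: (tnth ts i) => w /=; rewrite ?g_s ?h_s.
split=> [i|j|].
- rewrite (avals_y _ _ _ g_s) v_s g_s h_s /= -/(gy g i).
  case: asboolP => [_|no_t]; first by right; apply: other_neq.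
  by left=> y_t; apply: no_t; rewrite y_t.
- rewrite !g_s (avals_u _ _ _ _ h_s) v_s /urow.
  case: asboolP => [[ga_gc _ _]|_]; [by left|by right].
(* If inactive without escape, some premise atom is false. For a relational one, either [y i] is
   outside the relation and its flag is [c], or [y i] is a row and differs from the tuple of the
   atom. *)
have [act|inact] := pselect (active g); last first.
  have [ab|nab] := pselect (aval s a = aval s c \/ aval s b <> aval s c).
    by right; left.
  left; apply: contrapT => no_fail; apply: inact; split.
  - by move=> ga_gc; apply: nab; left; rewrite !g_s.
  - by apply: contrapT => gb_gc; apply: nab; right; rewrite !g_s.
  apply/conj_sat_tnth => i; apply: contrapT => fail_i; apply: no_fail.
  exists i; move: fail_i; rewrite /premise_fails.
  case: (tnth _ i) => [ts|q ts us] /=; last by rewrite !x_s.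
  rewrite (avals_y _ _ _ g_s) -/(gy g i) x_s g_s h_s /= => no_ts.
  case: asboolP => [y_X|]; last by right.
  by left=> y_ts; apply: no_ts; rewrite -y_ts.
right; right=> j; rewrite /conclusion_holds.
have := avals_u s t g j h_s; rewrite /urow asboolT //.
have [_ _ /F_dep/conj_sat_tnth/(_ j)] := act.
case: (tnth _ j) => [ts|q ts us] /=; last by rewrite !xz_s.
by rewrite xz_s.
Qed.

(** An equality generating dependency is handled as a tuple generating one whose conclusion is a
    single equality. *)
Lemma dependency_definable S (L : team_logic S) r (C : certificates L r)
    (v : r.-tuple var) (Delta : dependency r) :
  exists2 p : formula S (atom L), free_vars (@atom_fv S L) p `<=` [set` v] &
    forall (M : model S) (X : set (assignment M)),
      X !=set0 \/ relational_premise Delta ->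
      team_sat (@atom_sat S L M) X p <-> dep_sat (team_rel X v) Delta.
Proof.
case: Delta => [n k prem concl|n k prem l ts us] /=.
  exact: tgd_definable.
have [p fv_p sat_p] := tgd_definable C v prem [:: DEq ts us].
exists p => // M X /sat_p ->.
by split=> dep e /dep[f]; [case|]; exists f.
Qed.

Theorem proposition7p1 (S : signature) (r : nat) (Delta : dependency r)
    (v : r.-tuple var) (v_uniq : uniq v) :
  (exists2 phi : ie_formula S, ie_free_vars phi `<=` [set` v] &
     forall (M : model S) (D : set var) (X : set (assignment M)),
       team_on D X -> [set` v] `<=` D ->
       X !=set0 \/ relational_premise Delta ->
       (ie_team_sat X phi <-> dep_sat (team_rel X v) Delta)) /\
  (exists2 phi : ind_formula S, ind_free_vars phi `<=` [set` v] &
     forall (M : model S) (D : set var) (X : set (assignment M)),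
       team_on D X -> [set` v] `<=` D ->
       X !=set0 \/ relational_premise Delta ->
       (ind_team_sat X phi <-> dep_sat (team_rel X v) Delta)).
Proof.
split.
  have [p fv_p sat_p] := dependency_definable (ie_certificates S r) v Delta.
  by exists p => // M D X _ _; apply: sat_p.
have [p fv_p sat_p] := dependency_definable (ind_certificates S r) v Delta.
by exists p => // M D X _ _; apply: sat_p.
Qed.
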